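(* Let $d\ge1$ and let $G$ be a connected reductive $\mathbf F_p$-group of type $\mathsf A_1^d$ whose derived group has simply connected cover $\tilde G=\mathrm{Res}_{\mathbf F_{p^d}/\mathbf F_p}\mathrm{SL}(2)$, and let $\mu$ be a cocharacter of $G_k$ which is dominant and regular for an $\mathbf F_p$-Borel pair $(B,T)$ such that $\mu$ factors through $T_k$. For $I\subset\mathbf Z/d$ let $L_I=\prod_{i\in I}l_i\in\mathrm{CH}^{|I|}_{\mathbf Q}(G\text{-}\mathrm{Zip}^\mu)$ (with $L_\emptyset=1$) and write $$L_I=\sum_{J\subset\mathbf Z/d,\ |J|=|I|}a(I,J)[\overline{\mathcal X}^J],\qquad a(I,J)\in\mathbf Q.$$ For $|J|=|I|$ let $J^c=\bigsqcup_t[a_t,b_t]$ be the decomposition of the complement of $J$ into maximal intervals. Then: (a) $a(I,J)\ne0$ if and only if $|[a_t,b_t+1]\setminus I^c|=1$ for all $t$. (b) If $[a_t,b_t+1]\setminus I^c=\{a_t+e_t\}$ for all $t$, set $e(I,J)=\sum_te_t$; then $$a(I,J)=\frac{p^{e(I,J)}}{p^d+(-1)^{|I|}}.$$ In particular, if $a(I,J)\neq 0$, then $a(I,J)$ has this form, where the exponent $e(I,J)$ satisfies $e(I,I)=d-|I|$ and $0\le e(I,J)\le d-|I|-1$ for all $J\ne I$.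
   Context: $p$ is a prime, $k$ an algebraic closure of $\mathbf F_p$, $\varphi$ the Frobenius. For $(G,\mu)$ let $P$ (resp. $P^+$) be the parabolic of non-positive (resp. non-negative) $\mu$-weights (here opposite Borels, $P=B$), $Q=(P^+)^{(p)}$, $E=\{(a,b)\in P\times Q\mid\varphi(\bar a)=\bar b\}$ (bars: projections to Levi quotients) acting on $G_k$ by $(a,b)\cdot g=agb^{-1}$, and $G\text{-}\mathrm{Zip}^\mu=[E\backslash G_k]$. $\mathrm{CH}^*_{\mathbf Q}$ is the equivariant Chow ring with $\mathbf Q$-coefficients. There is $\tilde\mu\in X_*(\tilde G)$ with $G\text{-}\mathrm{Zip}^{\iota_*\tilde\mu}=G\text{-}\mathrm{Zip}^\mu$, $\iota:\tilde G\to G$ the natural map, and $\iota^*:\mathrm{CH}^*_{\mathbf Q}(G\text{-}\mathrm{Zip}^\mu)\to\mathrm{CH}^*_{\mathbf Q}(\tilde G\text{-}\mathrm{Zip}^{\tilde\mu})$ is an isomorphism matching classes of strata closures up to positive rational multiples; classes on $G\text{-}\mathrm{Zip}^\mu$ are described by their pullbacks to $\tilde G\text{-}\mathrm{Zip}^{\tilde\mu}$. Coordinates: identify $\tilde G_k=\mathrm{SL}(2)_k^{\mathbf Z/d}$ so that $\varphi(x)_{i+1}=x_i^{(p)}$, with $\tilde B$ the lower triangular matrices and $\tilde T$ the diagonal matrices in each factor; $e_i\in X^*(\tilde T)$ is the character $(\mathrm{diag}(t_j,t_j^{-1}))_j\mapsto t_i$. A character $\lambda$ gives a line bundle $\mathscr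 L(\lambda)$ (sections: functions with $f(\epsilon\cdot g)=\lambda(\epsilon)f(g)$), and $l_i=c_1\mathscr L(-e_i)$. One has $\mathrm{CH}^*_{\mathbf Q}(G\text{-}\mathrm{Zip}^\mu)=\mathbf Q[l_0,\dots,l_{d-1}]/(l_0^2,\dots,l_{d-1}^2)$. Strata: $\overline{\mathcal X}^i$ is the codimension one zip stratum closure given on $\tilde G\text{-}\mathrm{Zip}^{\tilde\mu}$ by $(g_{i+1})_{11}=0$, the zero scheme of a section of a line bundle with first Chern class $pl_i-l_{i+1}$; $\overline{\mathcal X}^J=\bigcap_{i\in J}\overline{\mathcal X}^i$, with $[\overline{\mathcal X}^J]=\prod_{i\in J}(pl_i-l_{i+1})$. The $\overline{\mathcal X}^J$, $J\subset\mathbf Z/d$, are exactly the zip strata closures and $\{[\overline{\mathcal X}^J]\}_{|J|=m}$ is a basis of $\mathrm{CH}^m_{\mathbf Q}$. Intervals: for $a,b\in\mathbf Z/d$, $[a,b]=\{a,a+1,\dots,b\}$ is obtained by successively adding $1$ (and $[a,a]=\{a\}$); in $[a_t,b_t+1]\setminus I^c=\{a_t+e_t\}$ the integer $e_t$ is taken with $0\le e_t\le|[a_t,b_t]|$. An interval $[a,b]\subset S$ is maximal in $S$ if $a-1,b+1\notin S$. If $J^c=\emptyset$ the decomposition is empty and $\sum_t e_t=0$. $S^c=\mathbf Z/d\setminus S$.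
   Formalization: The case I = J = ∅ is excluded: there Z/d has no decomposition into maximal intervals, and a(∅,∅) = 1 contradicts (a) and the formula p^d/(p^d+1); the result is proved for all nonempty I. *)

(* Defs.v *)
From HB Require Import structures.
From mathcomp Require Import all_boot all_order all_algebra.
From mathcomp Require Import mpoly.
Set Implicit Arguments. Unset Strict Implicit. Unset Printing Implicit Defensive.
Import GRing.Theory Num.Theory.
Local Open Scope ring_scope.

Definition psub T (A B : T -> Prop) := forall x, A x -> B x.
Definition peq T (A B : T -> Prop) := forall x, A x <-> B x.

Definition chain T (P : (T -> Prop) -> Prop) (n : nat) (c : nat -> T -> Prop) :=
  (forall i, (i <= n)%N -> P (c i)) /\
  (forall i, (i < n)%N -> psub (c i) (c i.+1) /\ ~ psub (c i.+1) (c i)).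

Definition longest_chain T (P : (T -> Prop) -> Prop) (n : nat) :=
  (exists c, chain P n c) /\ (forall m c, chain P m c -> (m <= n)%N).

(* A variety is identified with its set of [k]-points, a predicate on a type
   [T] endowed with a family [C] of coordinate functions. *)

Section Varieties.
Variables (k : closedFieldType) (T : Type) (C : (T -> k) -> Prop).

Inductive polyfun : (T -> k) -> Prop :=
| PolyCoord f of C f : polyfun f
| PolyConst c : polyfun (fun=> c)
| PolyAdd f g of polyfun f & polyfun g : polyfun (fun x => f x + g x)
| PolyMul f g of polyfun f & polyfun g : polyfun (fun x => f x * g x)
| PolyExt f g of polyfun f & f =1 g : polyfun g.

Definition vanishes (f : T -> k) (Z : T -> Prop) := forall x, Z x -> f x = 0.

Definition zclosed (Y Z : T -> Prop) :=
  psub Z Y /\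
  exists2 S : (T -> k) -> Prop, psub S polyfun &
    forall x, Y x -> (Z x <-> forall f, S f -> f x = 0).

Definition zclosure (Y Z : T -> Prop) (x : T) :=
  Y x /\ forall f, polyfun f -> vanishes f Z -> f x = 0.

Definition zconnected (Z : T -> Prop) :=
  (exists x, Z x) /\
  forall A B, zclosed Z A -> zclosed Z B -> (forall x, Z x -> A x \/ B x) ->
    (forall x, ~ (A x /\ B x)) -> (forall x, ~ A x) \/ (forall x, ~ B x).

Definition irr_closed (Y Z : T -> Prop) :=
  [/\ zclosed Y Z, exists x, Z x &
    forall f g, polyfun f -> polyfun g -> vanishes (fun x => f x * g x) Z ->
      vanishes f Z \/ vanishes g Z].

Definition codim (Y Z : T -> Prop) (m : nat) :=
  longest_chain (fun V => irr_closed Y V /\ psub Z V) m.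

Definition prime_divisor (Y W V : T -> Prop) :=
  [/\ irr_closed Y V, psub V W, ~ psub W V &
    forall Z, irr_closed Y Z -> psub V Z -> psub Z W -> peq Z V \/ peq Z W].

(* An ideal of the ring of polynomial functions which contains the ideal of
   [W] and [f] and is saturated with respect to the functions not vanishing
   identically on [V]; these correspond to the ideals of the quotient
   O_{W,V}/(f) of the local ring of [W] along [V]. *)
Definition local_ideal (W V : T -> Prop) (f : T -> k) (J : (T -> k) -> Prop) :=
  [/\ psub J polyfun,
      J f /\ (forall h, polyfun h -> vanishes h W -> J h),
      forall h1 h2, J h1 -> J h2 -> J (fun x => h1 x + h2 x),
      forall s h, polyfun s -> J h -> J (fun x => s x * h x) &
      forall s h, polyfun s -> polyfun h -> ~ vanishes s V ->
        J (fun x => s x * h x) -> J h].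

(* The order of [f] along [V] is the length of O_{W,V}/(f). *)
Definition is_ord (W V : T -> Prop) (f : T -> k) (n : nat) :=
  longest_chain (local_ideal W V f) n.

(* The divisor on [W] of the rational function [f/g] is the sum of the
   [c j] times [V j]. *)
Definition is_div (Y W : T -> Prop) (f g : T -> k)
    (s : nat) (c : 'I_s -> int) (V : 'I_s -> T -> Prop) :=
  [/\ forall j, prime_divisor Y W (V j),
      forall i j, peq (V i) (V j) -> i = j,
      forall j, exists a b : nat,
        [/\ is_ord W (V j) f a, is_ord W (V j) g b & c j = a%:Z - b%:Z] &
      forall V', prime_divisor Y W V' -> (forall j, ~ peq V' (V j)) ->
        exists2 a, is_ord W V' f a & is_ord W V' g a].

End Varieties.

Section Groups.
Variables (p : nat) (k : closedFieldType).

Definition alg_closure_Fp :=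
  p \in [pchar k] /\
  forall x : k, exists2 q : {poly int},
    map_poly intr q != 0 :> {poly k} & root (map_poly intr q) x.

Definition mxs (K : Type) (r n : nat) := {ffun 'I_r -> 'M[K]_n}.
Definition mxs_mul (K : comNzRingType) r n (x y : mxs K r n) : mxs K r n :=
  [ffun i => x i *m y i].
Definition mxs_one (K : comNzRingType) r n : mxs K r n := [ffun=> 1%:M].

Section Linear.
Variables r n : nat.
Notation M := (mxs k r n).
Notation mul := (@mxs_mul k r n).
Notation one := (mxs_one k r n).

Definition mxs_inv (x : M) : M := [ffun i => invmx (x i)].

(* The F_p-form of GL(n)^r given by this Frobenius is the Weil restriction of
   GL(n) from F_{p^r}; for r = 1 it is GL(n) itself. Note that
   [frob x (ordS i)] is the [p]-power twist of [x i]. *)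
Definition frob (x : M) : M :=
  [ffun i => map_mx (fun c => c ^+ p) (x (ord_pred i))].

Definition GLs (x : M) := forall i, x i \in unitmx.
Definition SL (x : M) := forall i, \det (x i) = 1.

Definition gcoord (f : M -> k) := exists i a b,
  (f =1 fun x => x i a b) \/ (f =1 fun x => invmx (x i) a b).

Definition is_group (H : M -> Prop) :=
  [/\ psub H GLs, H one, forall x y, H x -> H y -> H (mul x y) &
      forall x, H x -> H (mxs_inv x)].

Definition alg_group (H : M -> Prop) := is_group H /\ zclosed gcoord GLs H.

(* As F_p is perfect, smooth closed F_p-subgroups are the Frobenius-stable
   closed subgroups of the group of [k]-points. *)
Definition def_over_Fp (H : M -> Prop) := forall x, H (frob x) <-> H x.

Definition normal_in (H N : M -> Prop) :=
  psub N H /\ forall x y, H x -> N y -> N (mul (mul x y) (mxs_inv x)).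

Definition unipotent (x : M) :=
  forall i, exists m, iter m (mulmx (x i - 1%:M)) 1%:M = 0.

Definition reductive (H : M -> Prop) :=
  forall N, alg_group N -> normal_in H N -> zconnected gcoord N ->
    psub N unipotent -> psub N (eq one).

Definition derived (H : M -> Prop) (x : M) :=
  forall D, is_group D ->
    (forall y z, H y -> H z ->
      D (mul (mul y z) (mul (mxs_inv y) (mxs_inv z)))) -> D x.

Definition solvable_grp (H : M -> Prop) :=
  exists m, psub (iter m derived H) (eq one).

Definition borel (H B : M -> Prop) :=
  let ok B' := [/\ alg_group B', psub B' H, zconnected gcoord B' &
                   solvable_grp B'] in
  ok B /\ forall B', ok B' -> psub B B' -> peq B B'.

Definition torus (S : M -> Prop) :=
  [/\ alg_group S, zconnected gcoord S &
    exists2 u, GLs u &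
      forall x, S x -> forall i, is_diag_mx (u i *m x i *m invmx (u i))].

Definition maximal_torus (H S : M -> Prop) :=
  (torus S /\ psub S H) /\
  forall S', torus S' -> psub S' H -> psub S S' -> peq S S'.

Definition Fp_borel_pair (H B S : M -> Prop) :=
  [/\ borel H B, maximal_torus H S, psub S B, def_over_Fp B & def_over_Fp S].

(* Only the values of [mu] on nonzero elements of [k] are relevant. *)
Definition cochar (H : M -> Prop) (mu : k -> M) :=
  [/\ forall t, t != 0 -> H (mu t),
      forall s t, s != 0 -> t != 0 -> mu (s * t) = mul (mu s) (mu t) &
      exists N, forall i a b, exists P : {poly k},
        forall t, t != 0 -> t ^+ N * mu t i a b = P.[t]].

(* [x] is the limit of [c t] when [t] tends to zero. *)
Definition mxs_lim (c : k -> M) (x : M) :=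
  forall i a b, exists P : {poly k},
    (forall t, t != 0 -> c t i a b = P.[t]) /\ x i a b = P.[0].

Definition conj_by (mu : k -> M) (t : k) (g : M) :=
  mul (mul (mu t) g) (mxs_inv (mu t)).

(* [par_neg H mu g l] : [g] belongs to the parabolic of [H] with non-positive
   [mu]-weights, and [l] is its projection to the Levi quotient, identified
   with the centralizer of [mu]. *)
Definition par_neg (H : M -> Prop) (mu : k -> M) (g l : M) :=
  H g /\ mxs_lim (fun t => conj_by mu t^-1 g) l.
Definition par_pos (H : M -> Prop) (mu : k -> M) (g l : M) :=
  H g /\ mxs_lim (fun t => conj_by mu t g) l.

(* Dominance is normalized so that the parabolic of non-positive weights is
   the given Borel subgroup. *)
Definition dominant_regular (H B S : M -> Prop) (mu : k -> M) :=
  (forall g, B g <-> exists l, par_neg H mu g l) /\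
  (forall g, H g -> (forall t, t != 0 -> conj_by mu t g = g) -> S g).

(* The zip group E. An element of Q is the Frobenius twist of an element [b]
   of P^+, with Levi projection the twist of that of [b]. *)
Definition zip_group (H : M -> Prop) (mu : k -> M) (e : M * M) :=
  exists a' b b', [/\ par_neg H mu e.1 a', par_pos H mu b b',
    e.2 = frob b & frob a' = frob b'].

Definition zip_act (e : M * M) (g : M) := mul (mul e.1 g) (mxs_inv e.2).

Definition zip_stratum (H : M -> Prop) (mu : k -> M) (g : M) (x : M) :=
  exists2 e, zip_group H mu e & x = zip_act e g.

End Linear.

(* The equivariant Chow ring is computed on the mixed spaces (H x U_N)/E, where U_N is the open set
   of pairs of families of full rank n x N matrices, on which E acts freely by
   left multiplication. The complement of U_N has codimension N - n + 1, so
   that CH^m is computed with any N >= m + n. As E is connected here, the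
   integral closed subschemes of the quotient are the E-stable irreducible
   closed subsets of H x U_N, and the rational functions on such a subscheme
   are the E-invariant rational functions on the subset. *)

Section Chow.
Variables r n : nat.
Notation M := (mxs k r n).

Definition frames N := {ffun 'I_r -> 'M[k]_(n, N)}.
Definition mixed N := (M * (frames N * frames N))%type.

Definition mixed_act N (e : M * M) (y : mixed N) : mixed N :=
  (zip_act e y.1,
   ([ffun i => e.1 i *m y.2.1 i], [ffun i => e.2 i *m y.2.2 i])).

Definition mixed_coord N (f : mixed N -> k) :=
  (exists2 h, @gcoord r n h & f =1 fun y => h y.1) \/
  (exists i a b, (f =1 fun y => y.2.1 i a b) \/ (f =1 fun y => y.2.2 i a b)).

Definition mixed_space N (H : M -> Prop) (y : mixed N) :=
  H y.1 /\ forall i, \rank (y.2.1 i) = n /\ \rank (y.2.2 i) = n.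

Variables (H : M -> Prop) (E : M * M -> Prop).

Definition chow_subvar N m (V : mixed N -> Prop) :=
  [/\ irr_closed (@mixed_coord N) (mixed_space H) V,
      codim (@mixed_coord N) (mixed_space H) V m &
      forall e y, E e -> V y -> V (mixed_act e y)].

Definition pair_coord (f : M * M -> k) :=
  exists2 h, @gcoord r n h &
    (f =1 fun e => h e.1) \/ (f =1 fun e => h e.2).

Definition is_character (lam : M * M -> k) :=
  [/\ exists2 f, polyfun pair_coord f & forall e, E e -> lam e = f e,
      forall e, E e -> lam e != 0 &
      forall e e', E e -> E e' ->
        lam (mxs_mul e.1 e'.1, mxs_mul e.2 e'.2) = lam e * lam e'].

(* [f/g] is a nonzero rational section on [W] of the line bundle L(lam). *)
Definition rat_section N (W : mixed N -> Prop) (lam : M * M -> k)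
    (f g : mixed N -> k) :=
  [/\ polyfun (@mixed_coord N) f, polyfun (@mixed_coord N) g,
      ~ vanishes f W, ~ vanishes g W &
      forall e y, E e -> W y ->
        f (mixed_act e y) * g y = lam e * f y * g (mixed_act e y)].

Definition section_div N (W : mixed N -> Prop) (lam : M * M -> k)
    (s : nat) (c : 'I_s -> int) (V : 'I_s -> mixed N -> Prop) :=
  exists f g, rat_section W lam f g /\
    is_div (@mixed_coord N) (mixed_space H) W f g c V.

Variable A : comAlgType rat.

(* [gr m] is the degree [m] part, [c1 lam] the first Chern class of L(lam),
   and [cl V] the class of a subvariety of a mixed space. *)
Record chow_data := ChowData {
  gr : nat -> A -> Prop;
  c1 : (M * M -> k) -> A;
  cl : forall N, (mixed N -> Prop) -> A }.

Definition is_grading (D : nat -> A -> Prop) :=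
  [/\ forall m, D m 0 /\
        forall (q : rat) x y, D m x -> D m y -> D m (q *: x + y),
      D 0%N 1 /\ (forall m m' x y, D m x -> D m' y -> D (m + m')%N (x * y)),
      forall x, exists2 y : nat -> A, forall m, D m (y m) &
        exists b, x = \sum_(m < b) y m &
      forall (y : nat -> A) b, (forall m, D m (y m)) ->
        \sum_(m < b) y m = 0 -> forall m, (m < b)%N -> y m = 0].

(* [h] factors through rational equivalence of codimension [m] cycles. *)
Definition kills_rat_equiv N m (W : lmodType rat)
    (h : (mixed N -> Prop) -> W) :=
  forall m' Z s (c : 'I_s -> int) (V : 'I_s -> mixed N -> Prop),
    m = m'.+1 -> chow_subvar m' Z -> section_div Z (fun=> 1) c V ->
    \sum_j (c j)%:~R *: h (V j) = 0.

Definition cylinder N (Z : M -> Prop) (y : mixed N) :=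
  mixed_space H y /\ Z y.1.

(* The fourth and fifth clauses say that [gr m] is the group of codimension
   [m] cycles on the mixed space modulo rational equivalence, tensored with Q;
   the sixth clause pins down the product with first Chern classes, which
   generate the rings under consideration. *)
Record is_chow_ring (X : chow_data) : Prop := IsChowRing {
  chow_grading : is_grading (gr X);
  chow_cl_gr : forall N m V, (m + n <= N)%N ->
    chow_subvar m V -> gr X m (cl X (N := N) V);
  chow_one : forall N, (n <= N)%N -> cl X (N := N) (mixed_space H) = 1;
  chow_span : forall N m x, (m + n <= N)%N -> gr X m x ->
    exists s (q : 'I_s -> rat) (V : 'I_s -> mixed N -> Prop),
      (forall j, chow_subvar m (V j)) /\ x = \sum_j q j *: cl X (V j);
  chow_kernel : forall N m s (q : 'I_s -> rat) (V : 'I_s -> mixed N -> Prop),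
    (m + n <= N)%N -> (forall j, chow_subvar m (V j)) ->
    \sum_j q j *: cl X (V j) = 0 ->
    forall (W : lmodType rat) h, @kills_rat_equiv N m W h ->
      \sum_j q j *: h (V j) = 0;
  chow_c1 : forall N m lam Z s (c : 'I_s -> int) (V : 'I_s -> mixed N -> Prop),
    (m.+1 + n <= N)%N -> is_character lam -> chow_subvar m Z ->
    section_div Z lam c V ->
    c1 X lam * cl X Z = \sum_j (c j)%:~R *: cl X (V j);
  chow_c1_gr : forall lam, is_character lam -> gr X 1%N (c1 X lam);
  chow_cylinder : forall N N' m Z, (m + n <= N)%N -> (m + n <= N')%N ->
    chow_subvar m (cylinder (N := N) Z) ->
    cl X (cylinder (N := N) Z) = cl X (cylinder (N := N') Z) }.

(* The class of the closed substack of [E\H] defined by the E-stable closed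
   subset [Z] of [H] of codimension [m]. *)
Definition substack_class (X : chow_data) (m : nat) (Z : M -> Prop) : A :=
  cl X (cylinder (N := m + n) Z).

End Chow.

Section Cover.
Variables (d r n : nat).
Notation Mt := (mxs k d 2).
Notation M := (mxs k r n).

Notation sl2coord := ('I_d * ('I_2 * 'I_2))%type.

(* Polynomials in the matrix coefficients of the [d] factors of SL(2)^d. *)
Definition poly_map :=
  'I_r -> 'I_n -> 'I_n -> {mpoly k[#|{: sl2coord}|]}.

(* Action on points with values in a [k]-algebra given by [f]. *)
Definition eval_map (R : comNzRingType) (f : {rmorphism k -> R})
    (iota : poly_map) (g : mxs R d 2) : mxs R r n :=
  [ffun i => \matrix_(a, b)
     mmap f (fun c => let t := enum_val c in g t.1 t.2.1 t.2.2) (iota i a b)].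

Definition kpts (iota : poly_map) (g : Mt) : M :=
  eval_map (idfun : {rmorphism k -> k}) iota g.

(* [iota] is a central isogeny onto the derived group of [H], defined over
   F_p. Centrality is that of the scheme-theoretic kernel: over every
   [k]-algebra it consists of families of scalar matrices. *)
Definition simply_connected_cover (H : M -> Prop) (iota : poly_map) :=
  [/\ forall x y, SL x -> SL y ->
        kpts iota (mxs_mul x y) = mxs_mul (kpts iota x) (kpts iota y),
      forall x, SL x -> kpts iota (frob x) = frob (kpts iota x),
      forall y, derived H y <-> exists2 x, SL x & kpts iota x = y &
      forall (R : comNzRingType) (f : {rmorphism k -> R}) (g : mxs R d 2),
        (forall i, \det (g i) = 1) -> eval_map f iota g = mxs_one R r n ->
        forall i, is_scalar_mx (g i)].

(* The coordinates on SL(2)^d are such that the preimages of the Borel pair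
   are the lower triangular and the diagonal matrices. *)
Definition adapted (B S : M -> Prop) (iota : poly_map) :=
  forall x : Mt, SL x ->
    (B (kpts iota x) <-> forall i, x i 0 1 = 0) /\
    (S (kpts iota x) <-> forall i, x i 0 1 = 0 /\ x i 1 0 = 0).

(* [mut] is a cocharacter of the diagonal torus of SL(2)^d whose image under
   [iota] defines the same zip stack as [mu]. *)
Definition lifts_zip_datum (H : M -> Prop) (mu : k -> M) (iota : poly_map)
    (mut : k -> Mt) :=
  cochar (fun x => SL x /\ forall i, is_diag_mx (x i)) mut /\
  peq (zip_group H (fun t => kpts iota (mut t))) (zip_group H mu).

Definition is_pullback (H : M -> Prop) (mu : k -> M) (iota : poly_map)
    (mut : k -> Mt) (A At : comAlgType rat) (X : chow_data r n A)
    (Xt : chow_data d 2 At) (pull : A -> At) :=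
  [/\ bijective pull,
      forall lam, is_character (zip_group H mu) lam ->
        pull (c1 X lam) =
        c1 Xt (fun e => lam (kpts iota e.1, kpts iota e.2)) &
      forall g m, H g ->
        let Z := zclosure (@gcoord r n) H (zip_stratum H mu g) in
        codim (@gcoord r n) H Z m ->
        exists2 q : rat, 0 < q &
          pull (substack_class H X m Z) =
          q *: substack_class (@SL d 2) Xt m
                 (fun x => SL x /\ Z (kpts iota x))].

Definition minus_e (i : 'I_d) (e : Mt * Mt) : k := (e.1 i 0 0)^-1.

Definition stratum_closure (J : {set 'I_d}) (g : Mt) :=
  SL g /\ forall i, i \in J -> g (ordS i) 0 0 = 0.

(* Evaluation at [l] induces an isomorphism from Q[X_i]/(X_i^2) onto [A]. *)
Definition presented_by (A : comAlgType rat) (l : 'I_d -> A) :=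
  (forall x, exists P : {mpoly rat[d]}, mmap (GRing.in_alg A) l P = x) /\
  (forall P : {mpoly rat[d]}, mmap (GRing.in_alg A) l P = 0 <->
     exists Q : 'I_d -> {mpoly rat[d]}, P = \sum_i Q i * 'X_i ^+ 2).

End Cover.
End Groups.

Section Intervals.
Variable d : nat.
Implicit Types (a b : 'I_d) (S I : {set 'I_d}) (D : {set 'I_d * 'I_d}).

Definition cyc_interval a b : {set 'I_d} :=
  [set x : 'I_d | (x + (d - a)) %% d <= (b + (d - a)) %% d]%N.

Definition maximal_interval S a b :=
  [&& cyc_interval a b \subset S, ord_pred a \notin S & ordS b \notin S].

(* [D] is the set of pairs of end points of maximal intervals of [S] whose
   disjoint union is [S]. It exists except when [S] is all of Z/d, which
   contains no maximal interval. *)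
Definition maximal_decomposition S D :=
  [/\ forall t, t \in D -> maximal_interval S t.1 t.2,
      forall t u, t \in D -> u \in D -> t != u ->
        [disjoint cyc_interval t.1 t.2 & cyc_interval u.1 u.2] &
      \bigcup_(t in D) cyc_interval t.1 t.2 = S].

Definition interval_exponents I D (e : 'I_d * 'I_d -> nat) :=
  forall t, t \in D ->
    (e t <= #|cyc_interval t.1 t.2|)%N /\
    cyc_interval t.1 (ordS t.2) :\: ~: I = [set iter (e t) (@ordS d) t.1].

End Intervals.

(* Main.v *)
(* Put [y_i = c1(L(-e_i))], [x_i = p y_i - y_{i+1}] and [w_i = p y_i + y_{i+1}].
   Since [y_i^2 = 0], one has [x_i w_i = 0]; hence multiplication by
   [W = prod_(i notin J) w_i] kills every stratum class [prod_(i in K) x_i] with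
   [|K| = |J|] and [K <> J], while it sends that of [J] to [p^d + (-1)^|J|] times
   the top class [prod_i y_i]. So [a(I,J) (p^d + (-1)^|I|)] is the coefficient of
   the top class in [L_I W], and [W] is a product over the maximal intervals of
   the complement of [J]: over [[a_t,b_t]] it is the sum over [e] of [p^e] times
   the product of the [y_i], [i] in [[a_t,b_t+1]], [i <> a_t + e]. *)
Require Import Defs.
From mathcomp Require Import all_boot all_order all_algebra.
From mathcomp Require Import mpoly.
From mathcomp Require Import zify ring lra.
Set Implicit Arguments. Unset Strict Implicit. Unset Printing Implicit Defensive.
Import GRing.Theory Num.Theory.
Local Open Scope ring_scope.

(** * Cyclic intervals, parametrized by the distance from their starting point *)

Section CyclicIntervals.
Variable d : nat.
Implicit Types (a b x : 'I_d) (S : {set 'I_d}).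

(** Number of successive additions of 1 leading from [a] to [x]. Adding [d - a] stands for
    subtracting [a], which would truncate on naturals. *)
Definition cyc_offset a x := ((x + (d - a)) %% d)%N.

Lemma cyc_offset_lt a x : (cyc_offset a x < d)%N.
Proof. by rewrite ltn_mod (leq_trans _ (ltn_ord a)). Qed.

Lemma val_iter_ordS a j : iter j (@ordS d) a = ((a + j) %% d)%N :> nat.
Proof.
elim: j => [|j IHj]; first by rewrite addn0 modn_small.
by rewrite iterS /= IHj -addn1 modnDml addn1 addnS.
Qed.

Lemma cyc_offset_iter a j : (j < d)%N -> cyc_offset a (iter j (@ordS d) a) = j.
Proof.
move=> ltjd; rewrite /cyc_offset val_iter_ordS modnDml.
have -> : (a + j + (d - a) = j + d)%N by have := ltn_ord a; lia.
by rewrite modnDr modn_small.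
Qed.

Lemma iter_cyc_offset a x : iter (cyc_offset a x) (@ordS d) a = x.
Proof.
apply: val_inj; rewrite /= val_iter_ordS /cyc_offset modnDmr.
have -> : (a + (x + (d - a)) = x + d)%N by have := ltn_ord a; lia.
by rewrite modnDr modn_small.
Qed.

Lemma in_cyc_interval a b x :
  (x \in cyc_interval a b) = (cyc_offset a x <= cyc_offset a b)%N.
Proof. by rewrite inE. Qed.

Lemma cyc_offset_start a : cyc_offset a a = 0%N.
Proof.
have -> : cyc_offset a a = cyc_offset a (iter 0 (@ordS d) a) by [].
by rewrite cyc_offset_iter // (leq_trans _ (ltn_ord a)).
Qed.

(** Passes from cyclic to linear indexing, so that products over intervals can be treated by
    induction on naturals. *)
Lemma big_cyc_interval (R : Type) (idx : R) (op : Monoid.com_law idx) a b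
    (E : 'I_d -> R) :
  \big[op/idx]_(i in cyc_interval a b) E i =
  \big[op/idx]_(j < (cyc_offset a b).+1) E (iter j (@ordS d) a).
Proof.
have lt j : (j < (cyc_offset a b).+1)%N -> (j < d)%N.
  by move=> le; apply: leq_trans le (cyc_offset_lt a b).
rewrite (reindex_onto (fun j : 'I_(cyc_offset a b).+1 => iter j (@ordS d) a)
           (fun x => inord (cyc_offset a x))) /=; last first.
  by move=> i; rewrite in_cyc_interval => le; rewrite inordK // iter_cyc_offset.
apply: eq_bigl => j; rewrite in_cyc_interval cyc_offset_iter ?lt //.
rewrite -ltnS ltn_ord /=; apply/eqP/val_inj.
by rewrite /= inordK.
Qed.

Lemma card_cyc_interval a b : #|cyc_interval a b| = (cyc_offset a b).+1.
Proof. by rewrite -sum1_card big_cyc_interval sum1_card card_ord. Qed.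

Lemma cyc_interval_full a : cyc_interval a (ord_pred a) = setT.
Proof.
apply/eqP; rewrite eqEcard subsetT cardsT card_ord card_cyc_interval.
have d_gt0 : (0 < d)%N by apply: leq_trans (ltn_ord a).
have -> : ord_pred a = iter d.-1 (@ordS d) a.
  apply: ordS_inj; rewrite ord_predK -iterS prednK //; apply: val_inj.
  by rewrite /= val_iter_ordS modnDr modn_small.
by rewrite cyc_offset_iter prednK ?leqnn.
Qed.

Section Maximal.
Variables (S : {set 'I_d}) (a b : 'I_d).
Hypothesis maxS : maximal_interval S a b.

(** If the interval had [d] elements, [ordS b] would be [a], hence in [S], against maximality. So
    adding [ordS b] never wraps around. *)
Lemma maximal_interval_offset : ((cyc_offset a b).+1 < d)%N.
Proof.
have /and3P[/subsetP sub _ bS] := maxS.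
rewrite ltn_neqAle cyc_offset_lt andbT; apply: contraNneq bS => eqd.
rewrite -[b](iter_cyc_offset a) -iterS eqd sub // in_cyc_interval.
suff -> : iter d (@ordS d) a = a by rewrite cyc_offset_start.
by apply: val_inj; rewrite /= val_iter_ordS modnDr modn_small.
Qed.

Lemma maximal_interval_offsetS : cyc_offset a (ordS b) = (cyc_offset a b).+1.
Proof.
by rewrite -{1}[b](iter_cyc_offset a) -iterS cyc_offset_iter //
  maximal_interval_offset.
Qed.

Lemma maximal_intervalS :
  cyc_interval a (ordS b) = ordS b |: cyc_interval a b.
Proof.
apply/setP=> x; rewrite in_setU1 !in_cyc_interval maximal_interval_offsetS.
rewrite leq_eqVlt ltnS; congr (_ || _); apply/eqP/eqP=> [eqx|->].
  by rewrite -[x](iter_cyc_offset a) eqx iterS iter_cyc_offset.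
exact: maximal_interval_offsetS.
Qed.

End Maximal.
End CyclicIntervals.

Lemma big_bigcup_disjoint (T I : finType) (R : Type) (idx : R)
    (op : Monoid.com_law idx) (D : {set I}) (F : I -> {set T}) (E : T -> R) :
  {in D &, forall t u, t != u -> [disjoint F t & F u]} ->
  \big[op/idx]_(x in \bigcup_(t in D) F t) E x =
  \big[op/idx]_(t in D) \big[op/idx]_(x in F t) E x.
Proof.
move=> disjF; rewrite big_mkcond [in RHS]big_mkcond.
(* Indices outside [D] receive the empty set, which makes the family disjoint over the whole index
   type. *)
have -> : \bigcup_(t in D) F t = \bigcup_t (if t \in D then F t else set0).
  by rewrite big_mkcond.
rewrite -big_mkcond partition_disjoint_bigcup => [|t u neq].
  by apply: eq_bigr => t _; case: ifP => // _; rewrite big_set0.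
case: ifP => tD; last by rewrite disjoints_subset sub0set.
case: ifP => uD; first exact: disjF.
by rewrite disjoint_sym disjoints_subset sub0set.
Qed.

(** * Products of binomials in consecutive elements of square zero *)

Section SquareZero.
Variable R : comNzRingType.

(* Multiplying by [z e] forces the factors before [e] to contribute their
   first term and the later ones their second term. *)
Lemma mul_prod_consecutive (c : R) (s z : nat -> R) m e :
    (forall j, z j * z j = 0) -> (e <= m)%N ->
  z e * \prod_(j < m) (c * z j + s j * z j.+1) =
  c ^+ e * (\prod_(e <= j < m) s j) * \prod_(j < m.+1) z j.
Proof.
move=> zz; elim: m => [|m IHm] in e * => [|lem].
  by rewrite leqn0 => /eqP->; rewrite big_ord0 big_geq // big_ord1; ring.
rewrite big_ord_recr /= mulrA [in RHS]big_ord_recr /=.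
move: lem; rewrite leq_eqVlt => /predU1P[->|]; last first.
  (* For [e <= m] the product given by induction already contains [z m], so the new factor
     contributes only its second term. *)
  rewrite ltnS => lem; rewrite IHm // [in RHS]big_nat_recr //= [in LHS]big_ord_recr.
  rewrite [in RHS]big_ord_recr /=.
  transitivity (c ^+ e * (\prod_(e <= j < m) s j) * \prod_(i < m) z i *
                (c * (z m * z m) + s m * (z m * z m.+1))); first by ring.
  by rewrite zz; ring.
(* For [e = m.+1] the multiplier kills the second term of the new factor; the first one leaves
   [z m], and induction applies with [e = m]. *)
transitivity (c * (z m * \prod_(j < m) (c * z j + s j * z j.+1)) * z m.+1 +
   s m * (z m.+1 * z m.+1) * \prod_(j < m) (c * z j + s j * z j.+1)); first by ring.
by rewrite zz (IHm m) // !big_geq // exprS; ring.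
Qed.

Section Cyclic.
Variables (d : nat) (y : 'I_d -> R).
Hypothesis y_sqr : forall i, y i * y i = 0.

(** Only the last factor is expanded: its two terms multiply the others by [z m] and by [z 0], the
    extreme cases [e = m] and [e = 0] of [mul_prod_consecutive]. *)
Lemma prod_cyclic (c : R) (s : 'I_d -> R) : (0 < d)%N ->
  \prod_i (c * y i + s i * y (ordS i)) =
  (c ^+ d + \prod_i s i) * \prod_i y i.
Proof.
move=> d_gt0; pose a := Ordinal d_gt0.
have iter_prod (E : 'I_d -> R) :
    \prod_i E i = \prod_(j < d) E (iter j (@ordS d) a).
  rewrite -(eq_bigl _ _ (fun i => in_setT i)) -(cyc_interval_full a).
  by rewrite big_cyc_interval -card_cyc_interval cyc_interval_full cardsT card_ord.
rewrite 3!{}iter_prod.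
have iter_d : iter d (@ordS d) a = a.
  by apply: val_inj; rewrite /= val_iter_ordS modnDr modn_small.
pose z j := y (iter j (@ordS d) a); pose u j := s (iter j (@ordS d) a).
have zz j : z j * z j = 0 by exact: y_sqr.
have z_last : z d = z 0%N by rewrite /z iter_d.
rewrite -[LHS]/(\prod_(j < d) (c * z j + u j * z j.+1)).
rewrite -[RHS]/((c ^+ d + \prod_(j < d) u j) * \prod_(j < d) z j).
(* With [z] and [u] opaque, the goal no longer mentions [y] and [s], whose types depend on [d], and
   [d] can be replaced by [m.+1]. *)
clearbody z u; move: (esym (prednK d_gt0)); move: d.-1 => m dm.
rewrite dm in z_last *.
rewrite big_ord_recr /= z_last.
transitivity (c * (z m * \prod_(j < m) (c * z j + u j * z j.+1)) +
    u m * (z 0%N * \prod_(j < m) (c * z j + u j * z j.+1))); first by ring.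
rewrite !mul_prod_consecutive // big_geq // big_mkord exprS.
by rewrite [\prod_(_ < _.+1) u _]big_ord_recr /=; ring.
Qed.
End Cyclic.
End SquareZero.

(** * Consequences of the presentation of the Chow ring *)

Lemma presented_by_prod_neq0 (d : nat) (A : comAlgType rat) (y : 'I_d -> A) :
  presented_by y -> \prod_i y i != 0.
Proof.
move=> [_ presA]; pose P : {mpoly rat[d]} := 'X_[[multinom 1%N | i < d]].
have evalP : mmap (GRing.in_alg A) y P = \prod_i y i.
  by rewrite mmapX; apply: eq_bigr => i _; rewrite mnmE expr1.
apply/eqP; rewrite -evalP => /presA[Q /(congr1 (mcoeff [multinom 1%N | i < d]))].
rewrite mcoeffX eqxx raddf_sum big1 => [/eqP|i _]; first by rewrite oner_eq0.
(* The squarefree monomial is not divisible by the square of a variable, so its coefficient in each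
   [Q i * 'X_i ^+ 2] is zero. *)
rewrite /= mpolyXn mcoeffM big1 // => -[m1 m2] /= /eqP/mnmP/(_ i).
rewrite mcoeffX !mnmE; case: eqVneq => [<-|_ _]; last by rewrite mulr0.
by rewrite mulmnE mnm1E eqxx; lia.
Qed.

Lemma presented_by_sqr (d : nat) (A : comAlgType rat) (y : 'I_d -> A) i :
  presented_by y -> y i * y i = 0.
Proof.
move=> [_ presA]; have -> : y i * y i = mmap (GRing.in_alg A) y ('X_i ^+ 2).
  by rewrite expr2 rmorphM /= !mmapX mmap1U.
apply/presA; exists (fun j => (j == i)%:R).
rewrite (bigD1 i) //= eqxx mul1r big1 ?addr0 // => j /negPf->.
by rewrite mul0r.
Qed.

(** * Expansion along the maximal intervals of [S] *)

Section Decomposition.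
Variables (d : nat) (S : {set 'I_d}) (D : {set 'I_d * 'I_d}).
Hypothesis decD : maximal_decomposition S D.

Local Notation K t := (cyc_interval t.1 t.2).
Local Notation N t := (cyc_interval t.1 (ordS t.2)).

Lemma maximal_decomposition_max t : t \in D -> maximal_interval S t.1 t.2.
Proof. by case: decD => maxD _ _ /maxD. Qed.

Lemma maximal_decomposition_cover : \bigcup_(t in D) K t = S.
Proof. by case: decD. Qed.

Lemma maximal_decomposition_disjoint :
  {in D &, forall t u, t != u -> [disjoint K t & K u]}.
Proof. by case: decD => _ disjD _ t u; apply: disjD. Qed.

(** An added end point lies outside [S], hence in no [K u]; two added end points agree only if the
    intervals share their last point. *)
Lemma maximal_decomposition_disjointS :
  {in D &, forall t u, t != u -> [disjoint N t & N u]}.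
Proof.
have mem_end t : t.2 \in K t by rewrite in_cyc_interval.
have notin_end t u : t \in D -> u \in D -> ordS t.2 \notin K u.
  move=> /maximal_decomposition_max/and3P[_ _ tS].
  move=> /maximal_decomposition_max/and3P[/subsetP sub _ _].
  by apply: contra tS => /sub.
move=> t u tD uD neq; have dis := maximal_decomposition_disjoint tD uD neq.
rewrite (maximal_intervalS (maximal_decomposition_max tD)).
rewrite (maximal_intervalS (maximal_decomposition_max uD)).
rewrite -setI_eq0; apply/eqP/setP=> x; rewrite in_set0 in_setI !in_setU1.
apply/negP=> /andP[/predU1P[->|xt] /predU1P[]].
- move=> /ordS_inj eq2; move/pred0P: dis => /(_ t.2) /=.
  by rewrite mem_end eq2 mem_end.
- by apply/negP/notin_end.
- by move=> eqx; move: xt; rewrite eqx; apply/negP/notin_end.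
- by move=> xu; move/pred0P: dis => /(_ x) /=; rewrite xt xu.
Qed.

Lemma card_maximal_intervalS t : t \in D -> #|N t| = #|K t|.+1.
Proof.
move=> /maximal_decomposition_max maxt.
by rewrite !card_cyc_interval (maximal_interval_offsetS maxt).
Qed.

Lemma card_maximal_decomposition : (\sum_(t in D) #|K t|)%N = #|S|.
Proof.
rewrite -maximal_decomposition_cover -[RHS]sum1_card.
rewrite (big_bigcup_disjoint _ _ maximal_decomposition_disjoint).
by apply: eq_bigr => t _; rewrite sum1_card.
Qed.

Lemma card_maximal_decompositionS :
  #|\bigcup_(t in D) N t| = (#|S| + #|D|)%N.
Proof.
rewrite -[LHS]sum1_card (big_bigcup_disjoint _ _ maximal_decomposition_disjointS).
rewrite -card_maximal_decomposition -sum1_card -big_split /=.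
by apply: eq_bigr => t tD; rewrite sum1_card card_maximal_intervalS // addn1.
Qed.

Lemma meet_disjointS (I : {set 'I_d}) :
  {in D &, forall t u, t != u -> [disjoint N t :&: I & N u :&: I]}.
Proof.
move=> t u tD uD /(maximal_decomposition_disjointS tD uD).
by rewrite -!setI_eq0 => /eqP NN0; rewrite setIACA NN0 set0I.
Qed.

Lemma meet_bigcupS (I : {set 'I_d}) :
  I :&: \bigcup_(t in D) N t = \bigcup_(t in D) (N t :&: I).
Proof. by rewrite big_distrr /=; apply: eq_bigr => t _; rewrite setIC. Qed.

Lemma interval_exponents_exists (I : {set 'I_d}) :
  (forall t, t \in D -> #|N t :\: ~: I| = 1%N) -> exists e, interval_exponents I D e.
Proof.
(* The exponent is the offset of the unique point of the intersection; the default 0 is never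
   reached for [t] in [D]. *)
move=> card1; exists (fun t => if [pick x in N t :\: ~: I] is Some x
                               then cyc_offset t.1 x else 0%N).
move=> t tD; move/eqP/cards1P: (card1 t tD) => [x Nt].
rewrite Nt; case: pickP => [y|/(_ x)]; last by rewrite inE eqxx.
rewrite inE => /eqP-> {y}; rewrite iter_cyc_offset; split=> //.
have : x \in N t by have := set11 x; rewrite -Nt inE => /andP[].
rewrite in_cyc_interval card_cyc_interval.
by rewrite (maximal_interval_offsetS (maximal_decomposition_max tD)).
Qed.

Section Expansion.
Variables (R : comNzRingType) (y : 'I_d -> R) (c : R).
Hypothesis y_sqr : forall i, y i * y i = 0.
Local Notation w i := (c * y i + y (ordS i)).

Lemma mul_prod_interval t x : t \in D -> x \in N t ->
  y x * \prod_(i in K t) w i = c ^+ cyc_offset t.1 x * \prod_(i in N t) y i.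
Proof.
move=> /maximal_decomposition_max maxt; rewrite in_cyc_interval => lex.
rewrite !big_cyc_interval (maximal_interval_offsetS maxt) in lex *.
have := mul_prod_consecutive c (fun=> 1) (z := fun j => y (iter j (@ordS d) t.1))
  (fun j => y_sqr _) lex.
rewrite big1_eq mulr1 iter_cyc_offset => <-; congr (_ * _).
by apply: eq_bigr => j _; rewrite mul1r.
Qed.

(** One point of [I] turns the product over [K t] into a multiple of all [y i] with [i] in [N t]; a
    second point then produces a square. *)
Lemma mul_prod_interval_eq0 t (I : {set 'I_d}) :
    t \in D -> (1 < #|N t :&: I|)%N ->
  \prod_(i in N t :&: I) y i * \prod_(i in K t) w i = 0.
Proof.
move=> tD /card_gt1P[x [x' [xNI x'NI neq]]].
have [/setIP[xN _] /setIP[x'N _]] := (xNI, x'NI).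
rewrite (bigD1 x) //= (bigD1 x') /=; last by rewrite x'NI eq_sym.
set W := \prod_(i in K t) w i; set Q := (X in _ * (_ * X) * W).
rewrite (_ : _ * _ = Q * (y x' * (y x * W))); last by ring.
rewrite /W mul_prod_interval // [\prod_(i in N t) _](bigD1 x') //=.
by rewrite [y x' * _]mulrCA [y x' * (y x' * _)]mulrA y_sqr mul0r !mulr0.
Qed.

Variable I : {set 'I_d}.

Lemma prod_mul_split :
  \prod_(i in I) y i * \prod_(i in S) w i =
  \prod_(t in D) (\prod_(i in N t :&: I) y i * \prod_(i in K t) w i) *
  \prod_(i in I :\: \bigcup_(t in D) N t) y i.
Proof.
rewrite (big_setID (\bigcup_(t in D) N t)) /= meet_bigcupS.
rewrite (big_bigcup_disjoint _ _ (@meet_disjointS I)).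
rewrite -[in LHS]maximal_decomposition_cover.
rewrite (big_bigcup_disjoint _ _ maximal_decomposition_disjoint).
by rewrite big_split /=; ring.
Qed.

Hypothesis cardI : (#|I| + #|S|)%N = d.

Lemma prod_mul_exponents e : interval_exponents I D e ->
  \prod_(i in I) y i * \prod_(i in S) w i =
  c ^+ (\sum_(t in D) e t)%N * \prod_i y i.
Proof.
move=> expe; rewrite prod_mul_split.
have NI t : t \in D -> N t :&: I = [set iter (e t) (@ordS d) t.1].
  by move=> /expe[_ <-]; rewrite setDE setCK.
have -> : \prod_(t in D) (\prod_(i in N t :&: I) y i * \prod_(i in K t) w i) =
    \prod_(t in D) (c ^+ e t * \prod_(i in N t) y i).
  apply: eq_bigr => t tD; rewrite NI // big_set1.
  have [lee _] := expe t tD; rewrite card_cyc_interval in lee.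
  rewrite mul_prod_interval //; last first.
    by have := set11 (iter (e t) (@ordS d) t.1); rewrite -NI // inE => /andP[].
  rewrite cyc_offset_iter // (leq_ltn_trans lee) //.
  exact: maximal_interval_offset (maximal_decomposition_max tD).
rewrite big_split /= -expr_sum -mulrA; congr (_ * _).
rewrite -(big_bigcup_disjoint _ _ maximal_decomposition_disjointS).
set U := \bigcup_(t in D) N t.
(* The extended intervals fill [U]; the remaining factors must fill its complement. As [I] meets
   each [N t] once, [I :\: U] has [#|I| - #|D|] elements, which is the cardinality of [~: U]. *)
suff IU : ~: U \subset I.
  rewrite [RHS](bigID (mem U)) /=; congr (_ * _); apply: eq_bigl => i.
  rewrite in_setD; case: (boolP (i \in U)) => //= iU.
  by rewrite (subsetP IU) // inE.
have cardIU : #|I :&: U| = #|D|.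
  rewrite meet_bigcupS -sum1_card (big_bigcup_disjoint _ _ (@meet_disjointS I)).
  rewrite -[RHS]sum1_card; apply: eq_bigr => t tD.
  by rewrite sum1_card NI // cards1.
have eqIU : I :\: U = ~: U.
  apply/eqP; rewrite eqEcard subsetDr /=.
  have := cardsID U I; have := cardsC U; rewrite card_ord.
  have := card_maximal_decompositionS; rewrite -/U.
  move: cardI cardIU; move: #|~: U| #|I :\: U| #|I :&: U| #|U| #|I| #|S| #|D|; lia.
by rewrite -eqIU subsetDl.
Qed.

(** Pigeonhole: [I] has at least [#|D|] points in the union of the [N u]. If each [N u] contained at
    most one, each would contain exactly one, contrary to the choice of [t]. So some [N u] contains
    two, and its factor vanishes. *)
Lemma prod_mul_eq0 t : t \in D -> #|N t :\: ~: I| != 1%N ->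
  \prod_(i in I) y i * \prod_(i in S) w i = 0.
Proof.
rewrite setDE setCK => tD card_neq1.
have [u uD gt1] : exists2 u, u \in D & (1 < #|N u :&: I|)%N.
  apply/exists_inP; apply: contraNT card_neq1.
  rewrite negb_exists_in => /forall_inP le1.
  have {}le1 u : u \in D -> (#|N u :&: I| <= 1)%N by move/le1; rewrite -leqNgt.
  suff : (\sum_(u in D) 1 <= \sum_(u in D) #|N u :&: I|)%N.
    rewrite (bigD1 t) //= [X in (_ <= X)%N](bigD1 t) //= eqn_leq le1 //=.
    have le_rest : (\sum_(u in D | u != t) #|N u :&: I| <=
                    \sum_(u in D | u != t) 1)%N.
      by apply: leq_sum => u /andP[/le1].
    move=> le; rewrite -(leq_add2r (\sum_(u in D | u != t) 1)).
    by rewrite (leq_trans le) // leq_add2l.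
  have -> : (\sum_(u in D) #|N u :&: I|)%N = #|I :&: \bigcup_(u in D) N u|.
    rewrite meet_bigcupS -sum1_card (big_bigcup_disjoint _ _ (@meet_disjointS I)).
    by apply: eq_bigr => u _; rewrite sum1_card.
  rewrite sum1_card.
  have := card_maximal_decompositionS; set U := \bigcup_(u in D) N u.
  have := cardsID U I; have := cardsC U; rewrite card_ord.
  have := subset_leq_card (subsetDr I U : I :\: U \subset ~: U).
  move: cardI; move: #|~: U| #|I :\: U| #|I :&: U| #|U| #|I| #|S| #|D|; lia.
by rewrite prod_mul_split (bigD1 u) //= mul_prod_interval_eq0 // !mul0r.
Qed.

End Expansion.
End Decomposition.

(** * Values and bounds of the exponent *)

Section Exponents.
Variables (d : nat) (I J : {set 'I_d}) (D : {set 'I_d * 'I_d}).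
Hypotheses (decD : maximal_decomposition (~: J) D) (cardIJ : #|J| = #|I|).
Local Notation K t := (cyc_interval t.1 t.2).
Local Notation N t := (cyc_interval t.1 (ordS t.2)).

Lemma iter_card_cyc_interval (t : 'I_d * 'I_d) :
  iter #|K t| (@ordS d) t.1 = ordS t.2.
Proof. by rewrite card_cyc_interval iterS iter_cyc_offset. Qed.

(** Each maximal interval avoids [J], so the only point of [J] in the extended one is the added end
    point, at offset [#|K t|]. *)
Lemma interval_exponents_diag :
  interval_exponents J D (fun t => #|K t|) /\ (\sum_(t in D) #|K t|)%N = (d - #|J|)%N.
Proof.
split=> [t tD|]; last first.
  by rewrite (card_maximal_decomposition decD) cardsCs setCK card_ord.
have maxt := maximal_decomposition_max decD tD.
have /and3P[subK _ endJ] := maxt.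
split=> //; rewrite iter_card_cyc_interval (maximal_intervalS maxt) setDUl.
have -> : K t :\: ~: J = set0 by apply/eqP; rewrite setD_eq0.
by rewrite setU0; apply/setDidPl; rewrite disjoints1.
Qed.

(** Equality would force every exponent to be [#|K t|], so that [I] meets each extended interval
    only in its added end point. Then [I] avoids the complement of [J], and equals [J] by
    cardinality. *)
Lemma interval_exponents_lt e :
  J <> I -> interval_exponents I D e -> (\sum_(t in D) e t < d - #|I|)%N.
Proof.
move=> neqJI expe; have cardK : (\sum_(t in D) #|K t|)%N = (d - #|I|)%N.
  by rewrite (card_maximal_decomposition decD) cardsCs setCK card_ord cardIJ.
have lee t : t \in D -> (e t <= #|K t|)%N by move=> /expe[].
rewrite -cardK ltn_neqAle leq_sum ?andbT //; apply/eqP => eq_sum.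
have eqe t : t \in D -> e t = #|K t|.
  move=> tD; apply/eqP; rewrite eqn_leq lee //=.
  rewrite -(leq_add2r (\sum_(u in D | u != t) #|K u|)).
  move: eq_sum; rewrite (bigD1 t) //= [RHS](bigD1 t) //= => <-.
  by rewrite leq_add2l leq_sum // => u /andP[/lee].
apply: neqJI; apply/esym/eqP; rewrite eqEcard cardIJ leqnn andbT.
apply/subsetP=> i iI; apply: contraT => iJ.
have : i \in \bigcup_(t in D) K t.
  by rewrite (maximal_decomposition_cover decD) inE.
case/bigcupP=> t tD iK; have maxt := maximal_decomposition_max decD tD.
have [_] := expe t tD; rewrite eqe // iter_card_cyc_interval => /setP/(_ i).
rewrite (maximal_intervalS maxt) in_setD in_setC iI /= in_setU1 iK orbT in_set1.
move=> /esym/eqP eqi; move: iK; rewrite eqi in_cyc_interval.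
by rewrite (maximal_interval_offsetS maxt) ltnn.
Qed.

End Exponents.

(* As the squares vanish, [p y_i - y_{i+1}] annihilates [p y_i + y_{i+1}], so
   that multiplying by the latter for all [i] outside [J] kills every stratum
   class of the same codimension other than that of [J]. *)
Lemma coef_mul_top (d : nat) (A : comAlgType rat) (y : 'I_d -> A) (c : rat)
    (a : {set 'I_d} -> rat) (x : A) (J : {set 'I_d}) :
    (0 < d)%N -> (forall i, y i * y i = 0) ->
    x = \sum_(K : {set 'I_d} | #|K| == #|J|)
          a K *: \prod_(i in K) (c%:A * y i - y (ordS i)) ->
  x * \prod_(i in ~: J) (c%:A * y i + y (ordS i)) =
  (a J * (c ^+ d + (-1) ^+ #|J|)) *: \prod_i y i.
Proof.
move=> d_gt0 yy ->; rewrite mulr_suml (bigD1 J) //= [X in _ + X]big1 => [|K].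
  rewrite addr0 -scalerAl -scalerA; congr (_ *: _).
  (* The two products merge into one over Z/d, with sign -1 exactly on [J]; this is the origin of
     [(-1) ^+ #|J|]. *)
  transitivity (\prod_i (c%:A * y i + (if i \in J then -1 else 1) * y (ordS i))).
    rewrite [RHS](bigID (mem J)) /=; congr (_ * _).
      by apply: eq_bigr => i ->; rewrite mulN1r.
    by apply: eq_big => [i|i]; rewrite inE // => /negPf->; rewrite mul1r.
  rewrite prod_cyclic // -big_mkcond /= prodr_const.
  by rewrite -[RHS]mulr_algl -!in_algE rmorphD !rmorphXn rmorphN1.
move=> /andP[cardK neqK].
(* Such an [i] supplies the two factors whose product is a combination of squares. *)
have [i iK iJ] : exists2 i, i \in K & i \notin J.
  apply/subsetPn; apply: contraNN neqK => subKJ.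
  by rewrite eqEcard subKJ (eqP cardK) leqnn.
rewrite (bigD1 i) //= [X in _ * X](bigD1 i) ?inE //=.
rewrite -scalerAl; set P := \prod_(_ in _ | _) _; set Q := \prod_(_ in _ | _) _.
rewrite [X in _ *: X](_ : _ = (c%:A ^+ 2 * (y i * y i) - y (ordS i) * y (ordS i))
  * (P * Q)); last by ring.
by rewrite !yy mulr0 subr0 mul0r scaler0.
Qed.

Theorem theorem4p2p4
  (p d r n : nat) (k : closedFieldType)
  (G B T : mxs k r n -> Prop) (mu : k -> mxs k r n)
  (iota : poly_map k d r n) (mut : k -> mxs k d 2)
  (CH CHt : comAlgType rat)
  (chow : chow_data k r n CH) (chowt : chow_data k d 2 CHt)
  (pull : {lrmorphism CH -> CHt})
  (l : 'I_d -> CH) (X : {set 'I_d} -> CH)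
  (a : {set 'I_d} -> {set 'I_d} -> rat)
  (hp : prime p) (hk : alg_closure_Fp p k) (hd : (0 < d)%N)
  (* the group, its simply connected cover, the cocharacter *)
  (hG : alg_group G) (hGp : def_over_Fp p G)
  (hGconn : zconnected (@gcoord k r n) G) (hGred : reductive G)
  (hiota : simply_connected_cover p G iota)
  (hBT : Fp_borel_pair p G B T)
  (hmu : cochar G mu) (hmuT : forall t, t != 0 -> T (mu t))
  (hdom : dominant_regular G B T mu)
  (hadapt : adapted B T iota)
  (hmut : lifts_zip_datum p G mu iota mut)
  (* the Chow rings of the two zip stacks, and the pullback between them *)
  (hchow : is_chow_ring G (zip_group p G mu) chow)
  (hchowt : is_chow_ring (@SL k d 2) (zip_group p (@SL k d 2) mut) chowt)
  (hpull : is_pullback p G mu iota mut chow chowt pull)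
  (hl : forall i, pull (l i) = c1 chowt (minus_e i))
  (hX : forall J : {set 'I_d},
     pull (X J) = substack_class (@SL k d 2) chowt #|J| (stratum_closure J))
  (* the known presentation, and the known classes of the strata closures *)
  (hpres : presented_by (fun i => c1 chowt (minus_e i)))
  (hstrata : forall J : {set 'I_d},
     substack_class (@SL k d 2) chowt #|J| (stratum_closure J) =
     \prod_(i in J) (p%:R * c1 chowt (minus_e i)
                     - c1 chowt (minus_e (ordS i))))
  (ha : forall I : {set 'I_d},
     \prod_(i in I) l i =
     \sum_(J : {set 'I_d} | #|J| == #|I|) a I J *: X J)
  (I J : {set 'I_d}) (D : {set 'I_d * 'I_d})
  (hIJ : #|J| = #|I|) (hD : maximal_decomposition (~: J) D) :
  [/\ (* (a) *)
      a I J != 0 <->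
        (forall t, t \in D ->
           #|cyc_interval t.1 (ordS t.2) :\: ~: I| = 1%N),
      (* (b) *)
      forall e, interval_exponents I D e ->
        a I J = p%:R ^+ (\sum_(t in D) e t)%N
                / (p%:R ^+ d + (- 1) ^+ #|I|),
      a I J != 0 -> exists2 e, interval_exponents I D e &
        a I J = p%:R ^+ (\sum_(t in D) e t)%N
                / (p%:R ^+ d + (- 1) ^+ #|I|),
      J = I -> exists2 e, interval_exponents I D e &
        (\sum_(t in D) e t)%N = (d - #|I|)%N &
      J <> I -> forall e, interval_exponents I D e ->
        (\sum_(t in D) e t < d - #|I|)%N].

Proof.
pose y i := c1 chowt (minus_e i).
have yy i : y i * y i = 0 by apply: presented_by_sqr hpres.
have top_neq0 : \prod_i y i != 0 by apply: presented_by_prod_neq0.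
have p_gt1 : (1 < p)%N := prime_gt1 hp.
have cardIS : (#|I| + #|~: J|)%N = d by rewrite -hIJ cardsC card_ord.
set P : rat := p%:R ^+ d + (-1) ^+ #|I|.
have P_neq0 : P != 0.
  (* Since [p ^ d > 1], positivity survives even when the sign is -1. *)
  suff : 0 < P by apply: lt0r_neq0.
  have : 1 < p%:R ^+ d :> rat by rewrite exprn_egt1 ?ltr1n // -lt0n.
  by rewrite /P -signr_odd; case: odd => /=; rewrite ?expr1 ?expr0; lra.
pose W := \prod_(i in ~: J) (p%:R%:A * y i + y (ordS i)).
have aIJ : \prod_(i in I) y i * W = (a I J * P) *: \prod_i y i.
  rewrite /P -hIJ; apply: coef_mul_top => //.
  (* The expansion of [L_I] is transported along [pull] to the cover, where the strata classes are
     explicit products. *)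
  have -> : \prod_(i in I) y i = pull (\prod_(i in I) l i).
    by rewrite rmorph_prod; apply: eq_bigr => i _; exact/esym/hl.
  rewrite ha raddf_sum hIJ; apply: eq_bigr => K _.
  rewrite /= linearZ /= hX hstrata; congr (_ *: _); apply: eq_bigr => i _.
  by rewrite scaler_nat.
have formula e : interval_exponents I D e ->
    a I J = p%:R ^+ (\sum_(t in D) e t)%N / P.
  move=> expe; have := prod_mul_exponents hD p%:R%:A yy cardIS expe.
  rewrite -/W aIJ -in_algE -rmorphXn /= mulr_algl => /eqP.
  (* Both computations give rational multiples of the nonzero top class, so the scalars agree. *)
  rewrite -subr_eq0 -scalerBl scaler_eq0 (negPf top_neq0) orbF subr_eq0.
  by move=> /eqP <-; rewrite mulfK.
have card1 : a I J != 0 ->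
    forall t, t \in D -> #|cyc_interval t.1 (ordS t.2) :\: ~: I| = 1%N.
  (* If one interval fails the condition, the product with [W] is zero, hence so is [a I J * P]. *)
  move=> aN0 t tD; apply/eqP; apply: contraNT aN0 => card_neq1.
  move: aIJ; rewrite /W (prod_mul_eq0 hD _ yy cardIS tD card_neq1) => /esym/eqP.
  by rewrite scaler_eq0 (negPf top_neq0) orbF mulf_eq0 (negPf P_neq0) orbF.
split=> //.
- split=> // /(interval_exponents_exists hD)[e /formula->].
  by rewrite mulf_neq0 ?invr_eq0 // expf_neq0 // pnatr_eq0 -lt0n ltnW.
- by move=> /card1/(interval_exponents_exists hD)[e expe]; exists e; last exact: formula.
- move=> eqJI; have [expJ sumJ] := interval_exponents_diag hD.
  by exists (fun t => #|cyc_interval t.1 t.2|); rewrite -eqJI.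
- by move=> neqJI e; apply: (interval_exponents_lt hD hIJ).
Qed.
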